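(* Let $n$ be a positive integer and $N=2n$. Suppose we are given $n$ elements $d_1,d_2,\ldots,d_n \in (\mathbb{Z}/N)^*$ (not necessarily distinct). Then there exists a partition of $\mathbb{Z}/N$ into $n$ two-element subsets $\{x_1,y_1\},\ldots,\{x_n,y_n\}$ such that $x_i-y_i = d_i$ in $\mathbb{Z}/N$ for every $i=1,\ldots,n$ (i.e., the pairs have differences $d_1,\ldots,d_n$).
   Context: $(\mathbb{Z}/N)^*$ denotes the group of units of the ring $\mathbb{Z}/N$, i.e., residues coprime to $N$. A pair $\{x,y\}$ is said to have difference $d$ if $x-y=d$ or $y-x=d$; the labelling of $x_i$ and $y_i$ within each pair may be chosen freely. *)

(* Defs.v *)
From mathcomp Require Import all_boot all_order all_algebra.
Set Implicit Arguments.
Unset Strict Implicit.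
Unset Printing Implicit Defensive.

(* Main.v *)
(** Every [d i] is odd, so a pair of difference [d i] joins an even residue
    [2u] to an odd residue [2v + 1].  Writing [d i = 2k + 1], the two choices of
    which member is even require [u - v = k + 1] or [u - v = - k] in [Z/n].
    These two values differ by the unit [d i], so by a Cauchy-Davenport count
    the [n] binary choices can be made with total sum zero; M. Hall's theorem
    (a zero-sum family indexed by a finite abelian group is a difference of two
    permutations) then provides the bijections [u] and [v]. *)

Require Import Defs.
From mathcomp Require Import all_boot all_order all_algebra.
From mathcomp Require Import perm.
Set Implicit Arguments.
Unset Strict Implicit.
Unset Printing Implicit Defensive.
Import GRing.Theory.
Local Open Scope ring_scope.

(** A value of [f] on [K] is also a value of [g] on [K], so injectivity of [g] keeps it apart from
    the values of [g] off [K]. *)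
Lemma injective_if (I T : finType) (f g : I -> T) (K : {set I}) :
  injective f -> injective g -> f @: K = g @: K ->
  injective (fun i => if i \in K then f i else g i).
Proof.
move=> f_inj g_inj eqK.
have sep i j : i \in K -> j \notin K -> f i <> g j.
  move=> iK jK eq_ij; have: f i \in g @: K by rewrite -eqK imset_f.
  by rewrite eq_ij => /imsetP[l lK /g_inj ejl]; rewrite ejl lK in jK.
move=> i j /=; case: (boolP (i \in K)) => iK; case: (boolP (j \in K)) => jK.
- exact: f_inj.
- by move=> e; case: (sep i j).
- by move=> e; case: (sep j i).
- exact: g_inj.
Qed.

(* [K :\ i1] follows the path of the partial injection [x i |-> y i] (defined
   for [i] other than [i0], [i1]) that ends at the unmatched point [x i1]; the
   path starts at [y i0] or [y i1]. *)
Lemma alternating_path (I T : finType) (x y : I -> T) (i0 i1 : I) :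
  #|I| = #|T| -> injective x -> injective y -> i0 != i1 ->
  exists (K : {set I}) (k : I),
    [/\ i1 \in K, i0 \notin K, k = i0 \/ k = i1
      & x @: K = (y \o tperm i1 k) @: K].
Proof.
move=> cardIT x_inj y_inj i01.
(* One step of walking the path backwards from [x i1]: an index joins when its [y]-value is the
   [x]-value of [i1] or of an index already collected. *)
pose F (J : {set I}) :=
  [set j | [&& j != i0, j != i1 & y j \in x @: (i1 |: J)]].
have F_mono : {homo F : A B / A \subset B}.
  move=> A B sAB; apply/subsetP => j; rewrite !inE => /and3P[-> ->] /=.
  by apply: subsetP; apply/imsetS/setUS.
pose J := fixset F; have FJ : F J = J by exact: fixsetK.
have JP j : j \in J = [&& j != i0, j != i1 & y j \in x @: (i1 |: J)].
  by rewrite -{1}FJ inE.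
have i0J : i0 \notin J by rewrite JP eqxx.
have i1J : i1 \notin J by rewrite JP eqxx andbF.
have sub : y @: J \subset x @: (i1 |: J).
  by apply/subsetP => _ /imsetP[j jJ ->]; move: jJ; rewrite JP => /and3P[].
(* Counting yields a point [t] not hit by [y] on [J]. Its [y]-preimage [k] lies outside the fixed
   point [J], so only the excluded indices [i0] and [i1] remain: [t] is where the path starts. *)
have lt : (#|y @: J| < #|x @: (i1 |: J)|)%N.
  by rewrite !card_imset // cardsU1 i1J.
have [t tx tNy] : exists2 t, t \in x @: (i1 |: J) & t \notin y @: J.
  by apply/subsetPn; apply: contraL lt => /subset_leq_card; rewrite -leqNgt.
have [y' _ y'K] : bijective y by apply: inj_card_bij; rewrite ?cardIT.
set k := y' t; have ykt : y k = t by exact: y'K.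
have kJ : k \notin J by apply: contra tNy => kJ; rewrite -ykt imset_f.
have ki : k = i0 \/ k = i1.
  move: kJ; rewrite JP ykt tx andbT negb_and !negbK.
  by case/orP=> /eqP; [left | right].
exists (i1 |: J), k; split=> //; first by rewrite setU11.
  by rewrite !inE negb_or i01.
apply/esym/eqP; rewrite eqEcard; apply/andP; split; last first.
  by rewrite !card_imset //; apply: inj_comp y_inj (@perm_inj _ _).
apply/subsetP => _ /imsetP[j + ->]; rewrite !inE => /predU1P[->|jJ] /=.
  by rewrite tpermL ykt.
rewrite tpermD; first by apply: (subsetP sub); apply: imset_f.
  by apply: contraNneq i1J => ->.
by apply: contraNneq kJ => ->.
Qed.

(* With [z = c - y], prescribing [x i - y i] amounts to prescribing [x i + z i],
   which is unchanged when [x i] and [z i] are swapped, as is done along the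
   path; the choice of [c] gives [i0] the pair [(x i0, x i1)]. *)
Lemma exchange_difference (I : finType) (G : finZmodType) (x y : I -> G)
    (i0 i1 : I) (a : G) :
  #|I| = #|G| -> injective x -> injective y -> i0 != i1 ->
  exists x' y' : I -> G,
    [/\ injective x', injective y', x' i0 - y' i0 = a
      & forall j, j != i0 -> j != i1 -> x' j - y' j = x j - y j].
Proof.
move=> cardIG x_inj y_inj i01.
pose c := x i0 + x i1 - a; pose z i := c - y i.
have z_inj : injective z by move=> i j /addrI/oppr_inj/y_inj.
have [K [k [i1K i0K ki eqK]]] := alternating_path cardIG x_inj z_inj i01.
pose w := z \o tperm i1 k.
have w_inj : injective w by apply: inj_comp z_inj (@perm_inj _ _).
pose u i := if i \in K then w i else x i.
pose v i := if i \in K then x i else w i.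
have u_inj : injective u by apply: injective_if.
have v_inj : injective v by apply: injective_if.
exists u, (fun i => c - v (tperm i0 i1 i)); split=> //.
- by move=> i j /addrI/oppr_inj/v_inj/perm_inj.
- rewrite tpermL /u /v (negPf i0K) i1K /c.
  by rewrite [_ - a - _]addrAC addrK subKr.
- move=> j j0 j1; rewrite tpermD 1?eq_sym // /u /v.
  have -> : w j = z j.
    by rewrite /w /= tpermD 1?eq_sym //; case: ki => ->; rewrite // eq_sym.
  rewrite /z; case: ifP => _; last by rewrite subKr.
  by rewrite opprB addrC addrA subrK.
Qed.

(** The differences are corrected one index at a time, with [i1] absorbing each error. The
    difference at [i1] is then forced, because [x] and [y] both enumerate [G] and so all differences
    sum to zero, as the [a i] do. *)
Theorem hall_difference (I : finType) (G : finZmodType) (a : I -> G) :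
  #|I| = #|G| -> \sum_i a i = 0 ->
  exists x y : I -> G,
    [/\ injective x, injective y & forall i, x i - y i = a i].
Proof.
move=> cardIG suma.
have f_inj : injective (fun i : I => enum_val (cast_ord cardIG (enum_rank i))).
  by move=> i j /enum_val_inj/cast_ord_inj/enum_rank_inj.
have /card_gt0P[i1 _] : (0 < #|I|)%N.
  by rewrite cardIG; apply/card_gt0P; exists 0.
have partial (s : seq I) : i1 \notin s -> exists x y : I -> G,
    [/\ injective x, injective y & {in s, forall i, x i - y i = a i}].
  elim: s => [|i0 s IHs].
    by move=> _; do 2 eexists; split; [exact: f_inj | exact: f_inj |].
  rewrite inE negb_or eq_sym => /andP[i01 /[dup] i1s /IHs[x [y [x_inj y_inj xy]]]].
  have [x' [y' [x'_inj y'_inj xy0 xy']]] :=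
    exchange_difference (a i0) cardIG x_inj y_inj i01.
  exists x', y'; split=> // j; rewrite inE; case: eqVneq => [-> //|j0 /= js].
  by rewrite xy' ?xy //; apply: contraNneq i1s => <-.
have [|x [y [x_inj y_inj xy]]] := partial (enum (predC1 i1)).
  by rewrite mem_enum !inE eqxx.
have xyE i : i != i1 -> x i - y i = a i.
  by move=> ii1; apply: xy; rewrite mem_enum.
have sumE (f : I -> G) : injective f -> \sum_i f i = \sum_g g.
  move=> /inj_card_bij fbij; rewrite [RHS](reindex f) //.
  by apply: onW_bij; apply: fbij; rewrite cardIG.
exists x, y; split=> // i; have [->|/xyE//] := eqVneq i i1.
have: \sum_i (x i - y i) = \sum_i a i by rewrite suma sumrB !sumE // subrr.
rewrite (bigD1 i1) //= [RHS](bigD1 i1) //=.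
by rewrite [in LHS](eq_bigr a) // => /addIr.
Qed.

Section SubsetSums.

Variables (I : finType) (G : finZmodType) (d : I -> G).

Definition subset_sums (J : {set I}) : {set G} :=
  [set \sum_(i in S) d i | S : {set I} in powerset J].

Hypothesis d_gen : forall i u, exists k, u = d i *+ k.

(** A new index [j] either contributes a new sum, or the old set of sums is stable under adding
    [d j]. In the latter case it contains every multiple of [d j], starting from the empty sum, and
    is all of [G]. *)
Lemma leq_card_subset_sums (J : {set I}) :
  (minn #|G| #|J|.+1 <= #|subset_sums J|)%N.
Proof.
move Ek: #|J| => k; elim: k J Ek => [|k IHk] J.
  move/eqP; rewrite cards_eq0 => /eqP->; rewrite geq_min.
  apply/orP; right; apply/card_gt0P; exists 0; apply/imsetP; exists set0.
    by rewrite powersetE sub0set.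
  by rewrite big_set0.
move=> cardJ; have [j jJ] : exists j, j \in J by apply/card_gt0P; rewrite cardJ.
pose J' := J :\ j; have cardJ' : #|J'| = k.
  by move: cardJ; rewrite (cardsD1 j) jJ => -[].
have sub : subset_sums J' \subset subset_sums J.
  by apply/imsetS/subsetP => S; rewrite !powersetE => /subset_trans->;
    rewrite ?subD1set.
have shift u : u \in subset_sums J' -> d j + u \in subset_sums J.
  case/imsetP => S; rewrite powersetE subsetD1 => /andP[SJ jS] ->.
  apply/imsetP; exists (j |: S); last by rewrite big_setU1.
  by rewrite powersetE subUset sub1set jJ.
have leJ' := IHk _ cardJ'.
have [closed|] :=
  boolP [forall u in subset_sums J', d j + u \in subset_sums J'].
  have fullJ' u : u \in subset_sums J'.
    have [q ->] := d_gen j u; elim: q => [|q IHq].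
      apply/imsetP; exists set0; last by rewrite big_set0.
      by rewrite powersetE sub0set.
    by rewrite mulrS; have /forall_inP := closed; apply.
  rewrite geq_min -cardsT; apply/orP; left; apply: subset_leq_card.
  by apply/subsetP => u _; apply: (subsetP sub).
rewrite negb_forall_in => /exists_inP[u uJ' duJ'].
have lt : (#|subset_sums J'| < #|subset_sums J|)%N.
  apply/proper_card/properP; split=> //.
  by exists (d j + u); rewrite ?shift.
apply: leq_trans lt; apply: leq_trans (leJ' : _.+1 <= _.+1)%N.
by rewrite -minnSS leq_min !geq_min leqnSn leqnn !orbT.
Qed.

Lemma subset_sums_full (u : G) :
  (#|G| <= #|I|.+1)%N -> exists S : {set I}, \sum_(i in S) d i = u.
Proof.
move=> leGI; have := leq_card_subset_sums setT.
rewrite cardsT (minn_idPl leGI) => leG.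
have : u \in subset_sums setT.
  suff -> : subset_sums setT = setT by rewrite inE.
  by apply/eqP; rewrite eqEcard subsetT cardsT.
by case/imsetP => S _ ->; exists S.
Qed.

End SubsetSums.

(** The pairs cover [2 * #|I|] points while their sizes add up to at most that number. Equality
    forces them to be distinct and disjoint. *)
Lemma pairs_partition (T I : finType) (x y : I -> T) :
  #|T| = (2 * #|I|)%N -> (forall i, x i != y i) ->
  (forall z, exists i, z \in [set x i; y i]) ->
  partition [set [set x i; y i] | i : I] [set: T]
  /\ #|[set [set x i; y i] | i : I]| = #|I|.
Proof.
move=> cardT neq_xy surj; set P := [set _ | i : I].
have coverP : cover P = setT.
  apply/setP => z; rewrite inE; have [i zi] := surj z.
  by apply/bigcupP; exists [set x i; y i] => //; apply: imset_f.
have sumP : (\sum_(A in P) #|A| = 2 * #|P|)%N.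
  rewrite (eq_bigr (fun=> 2%N)) ?sum_nat_const 1?mulnC //.
  by move=> _ /imsetP[i _ ->]; rewrite cards2 neq_xy.
have leP : (#|P| <= #|I|)%N by exact: leq_imset_card.
have [le_cov eq_cov] := leq_card_cover P.
have cardP : #|P| = #|I|.
  apply/eqP; rewrite eqn_leq leP -(leq_pmul2l (isT : 0 < 2)%N) -sumP.
  by rewrite -cardT -cardsT -coverP.
split=> //; apply/and3P; split; first by rewrite coverP.
  by rewrite -eq_cov coverP sumP cardP cardsT cardT.
by apply/imsetP => -[i _ /setP/(_ (x i))]; rewrite !inE eqxx.
Qed.

Theorem theorem2p5 (n : nat) (hn : (0 < n)%N) (d : 'I_n -> 'Z_(2 * n)%N)
    (hd : forall i : 'I_n, d i \is a GRing.unit) :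
  exists x y : 'I_n -> 'Z_(2 * n)%N,
    [/\ partition [set [set x i; y i] | i : 'I_n] [set: 'Z_(2 * n)%N],
        #|[set [set x i; y i] | i : 'I_n]| = n,
        forall i : 'I_n, #|[set x i; y i]| = 2%N
      & forall i : 'I_n, x i - y i = d i].
Proof.
case: n hn d hd => // m _ d d_unit; set N := (2 * m.+1)%N in d d_unit *.
have N_gt1 : (1 < N)%N by rewrite /N mul2n.
have dN i : coprime N (d i) by rewrite -unitZpE // natr_Zp.
pose k i := (d i)./2.
have dE i : d i = (2 * k i).+1 :> nat.
  have : odd (d i) by have := dN i; rewrite /N coprimeMl coprime2n => /andP[].
  by rewrite mul2n -{2}[nat_of_ord (d i)]odd_double_half => ->.
(* ['I_m.+1] models Z/n also for n = 1, where ['Z_1] would have two elements; [g] is the class of 1,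
   which is 0 in that case. *)
pose g : 'I_m.+1 := inZp 1.
have val_g j : g *+ j = (j %% m.+1)%N :> nat.
  by rewrite Zp_mulrn /= modnMml mul1n.
(* Doubling is well defined from Z/n to Z/2n. *)
have embed (u v : 'I_m.+1) j :
    u = v + g *+ j -> (2 * u)%:R = (2 * (v + j))%:R :> 'Z_N.
  move=> -> /=; rewrite val_g modnDmr muln_modr.
  exact: Zp_nat_mod.
have g_gen i (u : 'I_m.+1) : exists q, u = g *+ d i *+ q.
  have cop : coprime (d i) m.+1.
    by have := dN i; rewrite /N coprimeMl coprime_sym => /andP[_];
      rewrite coprime_sym.
  (* [c] is a multiple of [d i] congruent to [u] modulo n. *)
  pose c := chinese (d i) m.+1 0 u; exists (c %/ d i)%N.
  have dvd_c : (d i %| c)%N by rewrite /dvdn /c chinese_modl ?mod0n.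
  apply: val_inj; rewrite -mulrnA mulnC divnK //= val_g /c chinese_modr //.
  by rewrite modn_small.
(* If every index takes the value [- k i], switching those in [S] to [k i + 1] adds [d i] for each;
   [S] is chosen to bring the total to zero. *)
have [|S sumS] := subset_sums_full g_gen (\sum_i g *+ k i).
  by rewrite !card_ord.
pose a i := if i \in S then g *+ (k i).+1 else - (g *+ k i).
have aE i : a i = (if i \in S then g *+ d i else 0) - g *+ k i.
  rewrite /a; case: ifP => _; last by rewrite sub0r.
  by rewrite dE mul2n -addnn -addSn mulrnDr addrK.
have suma : \sum_i a i = 0.
  by rewrite (eq_bigr _ (fun i _ => aE i)) sumrB -big_mkcond sumS subrr.
have [u [v [u_inj v_inj uv]]] := hall_difference (erefl _) suma.
pose X i : 'Z_N := (2 * u i)%:R; pose Y i : 'Z_N := (2 * v i).+1%:R.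
(* On [S] the even member comes first: 2u - (2v + 1) = 2(k + 1) - 1. Off [S] the odd one does: (2v +
   1) - 2u = 2k + 1. *)
pose x i := if i \in S then X i else Y i.
pose y i := if i \in S then Y i else X i.
have xy i : x i - y i = d i.
  apply/eqP; rewrite subr_eq -[d i]natr_Zp dE /x /y /X /Y.
  have := uv i; rewrite /a; case: ifP => _ /eqP; rewrite subr_eq.
    rewrite addrC => /eqP/embed ->; rewrite -natrD.
    by apply/eqP; congr _%:R; rewrite !mulnDr mulnS addnS addSn addnC.
  rewrite addrC eq_sym subr_eq => /eqP/embed E.
  rewrite -[X in X == _]natr1 E natr1 -natrD.
  by apply/eqP; congr _%:R; rewrite mulnDr addSn addnC.
have neq_xy i : x i != y i.
  by apply: contraTneq (d_unit i) => eqi; rewrite -xy eqi subrr unitr0.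
have setE i : [set x i; y i] = [set X i; Y i].
  by rewrite /x /y; case: ifP => _ //; rewrite setUC.
have surj z : exists i, z \in [set x i; y i].
  have z2 : (z./2 < m.+1)%N.
    rewrite -ltn_double -[(m.+1).*2]mul2n -[X in (_ < X)%N](Zp_cast N_gt1).
    by apply: leq_ltn_trans (ltn_ord z);
      rewrite -{2}[nat_of_ord z]odd_double_half leq_addl.
  pose w := Ordinal z2; case: (boolP (odd z)) => odd_z.
    have [v' _ v'K] := injF_bij v_inj; exists (v' w).
    rewrite setE !inE /Y v'K /= mul2n; apply/orP; right.
    by rewrite -[X in X == _]natr_Zp -{1}[nat_of_ord z]odd_double_half odd_z.
  have [u' _ u'K] := injF_bij u_inj; exists (u' w).
  rewrite setE !inE /X u'K /= mul2n; apply/orP; left.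
  by rewrite -[X in X == _]natr_Zp -{1}[nat_of_ord z]odd_double_half (negPf odd_z).
have [|part card_part] := pairs_partition _ neq_xy surj.
  by rewrite !card_ord Zp_cast.
exists x, y; split=> //; first by rewrite card_part card_ord.
by move=> i; rewrite cards2 neq_xy.
Qed.
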